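(* For $p=210$, we have $$C_p(x,y)=\frac{1-5x+8x^2-x^2y-4x^3+3x^3y-x^4y}{(1-2x)(1-4x+4x^2-x^2y+x^3y)}.$$
   Context: A Catalan word of length $n\geq 1$ is a word $w_1\ldots w_n$ over the non-negative integers with $w_1=0$ and $0\leq w_i\leq w_{i-1}+1$ for $2\leq i\leq n$; the empty word is the unique Catalan word of length $0$. A word $w$ contains the pattern $p=p_1\ldots p_k$ if there are indices $i_1<\cdots<i_k$ such that $w_{i_1}\ldots w_{i_k}$ is order-isomorphic to $p$ (for all $a,b$: $w_{i_a}<w_{i_b}$ iff $p_a<p_b$, and $w_{i_a}=w_{i_b}$ iff $p_a=p_b$); otherwise $w$ avoids $p$. $\mathcal{C}_n(p)$ is the set of Catalan words of length $n$ avoiding $p$. A descent of $w$ is an index $i$ with $w_i>w_{i+1}$. $C_p(x,y)=\sum_{n,k\geq 0}c_{n,k}x^ny^k$, where $c_{n,k}$ is the number of words in $\mathcal{C}_n(p)$ with exactly $k$ descents. *)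

(* Defs.v *)
From HB Require Import structures.
From mathcomp Require Import all_boot all_order all_algebra.
From mathcomp Require Import boolp.

Set Implicit Arguments.
Unset Strict Implicit.
Unset Printing Implicit Defensive.

Import GRing.Theory.

(* Words over the non-negative integers are sequences [w : seq nat], with
   letters numbered from 0. *)

Definition is_catalan (w : seq nat) : bool :=
  (head 0 w == 0) && sorted (fun a b => b <= a.+1) w.

Definition contains (p w : seq nat) : bool :=
  [exists f : {ffun 'I_(size p) -> 'I_(size w)},
    [forall a : 'I_(size p), forall b : 'I_(size p),
      [&& (a < b) ==> (f a < f b),
          (nth 0 w (f a) < nth 0 w (f b)) == (nth 0 p a < nth 0 p b) &
          (nth 0 w (f a) == nth 0 w (f b)) == (nth 0 p a == nth 0 p b)]]].

Definition avoids (p w : seq nat) : bool := ~~ contains p w.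

Definition descents (w : seq nat) : nat :=
  #|[set i : 'I_(size w).-1 | nth 0 w i > nth 0 w i.+1]|.

(* Every letter of a Catalan word is smaller than its length, so that the
   Catalan words of length n are among the words over {0, ..., n-1}. *)
Lemma is_catalan_lt_size (w : seq nat) :
  is_catalan w -> all (fun a => a < size w) w.
Proof.
case: w => [|a s] //=; rewrite /is_catalan /= => /andP[/eqP -> {a}].
suff H k m : k < m -> path (fun a b => b <= a.+1) k s ->
    all (fun a => a < m + size s) s.
  by move=> /(H 0 1 isT); rewrite add1n.
elim: s k m => [|b s IH] k m //= km /andP[bk ps].
have bm : b < m.+1 by rewrite ltnS (leq_trans bk).
rewrite addnS -addSn (IH b) // andbT.
exact: leq_trans bm (leq_addr _ _).
Qed.

Definition catalan_avoiding (p : seq nat) (n : nat) : {set n.-tuple 'I_n} :=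
  [set w : n.-tuple 'I_n |
    is_catalan (map val w) && avoids p (map val w)].

Definition catalan_count (p : seq nat) (n k : nat) : nat :=
  #|[set w in catalan_avoiding p n | descents (map val w) == k]|.

Local Open Scope ring_scope.

(* [fps R] is the ring R[[t]]; it is wrapped in a record because [nat -> R]
   already carries the pointwise product. *)
Record fps (R : Type) := Fps { coefs : nat -> R }.

HB.instance Definition _ (R : Type) := gen_eqMixin (fps R).
HB.instance Definition _ (R : Type) := gen_choiceMixin (fps R).

Section FpsRing.
Variable R : comNzRingType.
Implicit Types f g h : fps R.

Lemma fpsP f g : (forall n, coefs f n = coefs g n) -> f = g.
Proof. by case: f g => [f] [g] /= fg; congr Fps; apply: funext. Qed.

Definition fps_zero : fps R := Fps (fun=> 0).
Definition fps_opp f := Fps (fun n => - coefs f n).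
Definition fps_add f g := Fps (fun n => coefs f n + coefs g n).
Definition fps_one : fps R := Fps (fun n => (n == 0)%:R).
Definition fps_mul f g :=
  Fps (fun n => \sum_(i < n.+1) coefs f i * coefs g (n - i)%N).

Fact fps_addA : associative fps_add.
Proof. by move=> f g h; apply: fpsP => n /=; rewrite addrA. Qed.
Fact fps_addC : commutative fps_add.
Proof. by move=> f g; apply: fpsP => n /=; rewrite addrC. Qed.
Fact fps_add0 : left_id fps_zero fps_add.
Proof. by move=> f; apply: fpsP => n /=; rewrite add0r. Qed.
Fact fps_addN : left_inverse fps_zero fps_opp fps_add.
Proof. by move=> f; apply: fpsP => n /=; rewrite addNr. Qed.

HB.instance Definition _ :=
  GRing.isZmodule.Build (fps R) fps_addA fps_addC fps_add0 fps_addN.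

Let trunc n f : {poly R} := \poly_(i < n) coefs f i.

Let coef_trunc_mul n f g i : (i < n)%N ->
  coefs (fps_mul f g) i = (trunc n f * trunc n g)`_i.
Proof.
move=> lin; rewrite coefM /=; apply: eq_bigr => j _.
rewrite !coef_poly (leq_ltn_trans _ lin) ?(leq_ltn_trans _ lin) //.
  exact: leq_subr.
by rewrite -ltnS.
Qed.

Fact fps_mulC : commutative fps_mul.
Proof.
move=> f g; apply: fpsP => n.
by rewrite !(@coef_trunc_mul n.+1) // mulrC.
Qed.

Fact fps_mulA : associative fps_mul.
Proof.
move=> f g h; apply: fpsP => n.
transitivity ((trunc n.+1 f * (trunc n.+1 g * trunc n.+1 h))`_n).
  rewrite coefM; apply: eq_bigr => i _.
  rewrite coef_poly ltn_ord; congr (_ * _).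
  by rewrite (@coef_trunc_mul n.+1) // ltnS leq_subr.
rewrite mulrA coefM; apply: eq_bigr => i _.
by rewrite (@coef_trunc_mul n.+1) // coef_poly ltnS leq_subr.
Qed.

Fact fps_mul1 : left_id fps_one fps_mul.
Proof.
move=> f; apply: fpsP => n /=.
rewrite big_ord_recl /= mul1r subn0 big1 ?addr0 // => i _.
by rewrite mul0r.
Qed.

Fact fps_mulDl : left_distributive fps_mul fps_add.
Proof.
move=> f g h; apply: fpsP => n /=.
by rewrite -big_split /=; apply: eq_bigr => i _; rewrite mulrDl.
Qed.

Fact fps_one_neq0 : fps_one != fps_zero.
Proof.
apply/eqP => /(congr1 (fun f => coefs f 0%N)) /= /eqP.
by rewrite oner_eq0.
Qed.

HB.instance Definition _ := GRing.Zmodule_isComNzRing.Build (fps R)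
  fps_mulA fps_mulC fps_mul1 fps_mulDl fps_one_neq0.

Definition fps_unit : {pred fps R} := fun f => `[< exists g, g * f = 1 >].

Definition fps_inv f : fps R :=
  if pselect (exists g, g * f = 1) is left e then projT1 (cid e) else f.

Fact fps_mulV : {in fps_unit, left_inverse 1 fps_inv *%R}.
Proof.
move=> f; rewrite /fps_inv => /asboolP uf.
by case: pselect => // e; case: cid.
Qed.

Fact fps_unitPl f g : g * f = 1 -> fps_unit f.
Proof. by move=> gf; apply/asboolP; exists g. Qed.

Fact fps_inv_out : {in [predC fps_unit], fps_inv =1 id}.
Proof.
move=> f; rewrite /fps_inv => /asboolP nuf.
by case: pselect.
Qed.

HB.instance Definition _ := GRing.ComNzRing_hasMulInverse.Build (fps R)
  fps_mulV fps_unitPl fps_inv_out.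

Definition fpsC (c : R) : fps R := Fps (fun n => if n == 0%N then c else 0).
Definition fpsX : fps R := Fps (fun n => (n == 1)%:R).

End FpsRing.

(* A series is invertible as soon as its constant coefficient is, hence the
   quotient of power series by such a series is a genuine one. *)
Lemma fps_unitP (R : comUnitRingType) (f : fps R) :
  reflect (coefs f 0 \is a GRing.unit) (f \is a GRing.unit).
Proof.
apply: (iffP idP) => [/divrr ff1|u0].
  apply/unitrPr; exists (coefs f^-1 0%N).
  move/(congr1 (fun g => coefs g 0%N)): ff1 => /=.
  by rewrite big_ord_recl big_ord0 addr0.
pose v := (coefs f 0%N)^-1.
pose next n (s : seq R) := - (v * \sum_(j < n.+1) coefs f (n.+1 - j)%N * s`_j).
pose s n := iteri n (fun n s => rcons s (next n s)) [:: v].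
have sz n : size (s n) = n.+1 by elim: n => //= n IH; rewrite size_rcons IH.
have sE m j : (j <= m)%N -> (s m)`_j = (s j)`_j.
  elim: m => [|m IH]; first by case: j.
  rewrite leq_eqVlt => /predU1P[-> //|jm].
  by rewrite /= nth_rcons sz jm IH.
apply/unitrPr; exists (Fps (fun n => (s n)`_n)).
rewrite mulrC; apply: fpsP => -[|n] /=.
  by rewrite big_ord_recl big_ord0 addr0 mulVr.
rewrite big_ord_recr /= subnn nth_rcons sz ltnn eqxx /next mulNr.
rewrite mulrAC mulVr // mul1r; apply/eqP; rewrite subr_eq0; apply/eqP; apply: eq_bigr => i _.
by rewrite mulrC sE // -ltnS.
Qed.

(* The ring Z[[x,y]], as Z[[y]][[x]]. *)
Definition fps2 := fps (fps int).

Definition varx : fps2 := fpsX (fps int).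
Definition vary : fps2 := fpsC (fpsX int).

(* C_p(x,y) = sum_(n,k) c_(n,k) x^n y^k. *)
Definition catalan_gf (p : seq nat) : fps2 :=
  Fps (fun n => Fps (fun k => (catalan_count p n k)%:R)).

(* Main.v *)
(** Read a Catalan word avoiding 210 from left to right, and let [M] be the
    largest letter so far, [c] the last one, and [b] the largest letter having a
    greater letter to its left. The next letter ranges over the interval
    from [b] to [c + 1], and [c < M] forces [b = c], so the number of
    continuations depends only on [d := M - b] and on whether [c = M] (series
    [T d]) or [c < M] (series [L d], [d > 0]). With the convention
    [L 0 := T 1] this reads
      [T d = 1 + x (T (d + 1) + T d + y (L 1 + ... + L d))] and
      [L (d + 1) = 1 + x (L (d + 1) + L d)],
    a system that determines all coefficients by induction on the length, and
    [C = 1 + x T 0]. With [r := x / (1 - x)], it is solved by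
    [L d = 1 / (1 - 2 x) + U r ^ d] and [T d] of the form
    [alpha + beta d + gamma r ^ d]. *)

Require Import Defs.
From mathcomp Require Import all_boot all_order all_algebra.
From mathcomp Require Import zify ring.

Set Implicit Arguments.
Unset Strict Implicit.
Unset Printing Implicit Defensive.

Import GRing.Theory.

(** * Occurrences of 210 and words extended by one letter *)

Lemma subseq_rcons2 (T : eqType) (s w : seq T) (y a : T) :
  subseq (rcons s y) (rcons w a) =
  subseq (rcons s y) w || (y == a) && subseq s w.
Proof.
rewrite -subseq_rev !rev_rcons -[X in _ = X || _]subseq_rev rev_rcons.
rewrite -[X in _ = _ || _ && X]subseq_rev /=.
case: eqP => [_|_] /=; last by rewrite orbF.
case sub: (subseq (rev s) (rev w)); first by rewrite orbT.
by rewrite orbF; apply/esym/negP => /(subseq_trans (subseq_cons _ _)); rewrite sub.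
Qed.

Lemma contains210P (w : seq nat) :
  reflect (exists x y z, [/\ z < y, y < x & subseq [:: x; y; z] w])
          (contains [:: 2; 1; 0] w).
Proof.
apply: (iffP existsP) => [[f /forallP fP]|[x [y [z [zy yx /subseqP[m _ sE]]]]]].
- pose i0 : 'I_3 := inord 0; pose i1 : 'I_3 := inord 1; pose i2 : 'I_3 := inord 2.
  have /and3P[_ /eqP w01 _] := forallP (fP i1) i0.
  have /and3P[_ /eqP w12 _] := forallP (fP i2) i1.
  have /and3P[/implyP g01 _ _] := forallP (fP i0) i1.
  have /and3P[/implyP g12 _ _] := forallP (fP i1) i2.
  rewrite !inordK //= in w01 w12 g01 g12.
  exists (nth 0 w (f i0)), (nth 0 w (f i1)), (nth 0 w (f i2)).
  split; [by rewrite w12 | by rewrite w01 | ].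
  have lt01 := g01 isT; have lt12 := g12 isT.
  have -> : [:: nth 0 w (f i0); nth 0 w (f i1); nth 0 w (f i2)] =
    map (nth 0 w) [:: f i0 : nat; f i1 : nat; f i2 : nat] by [].
  rewrite -[X in subseq _ X](mkseq_nth 0) /mkseq map_subseq //.
  apply/subseq_uniqP; first exact: iota_uniq.
  (* Both index lists are strictly increasing, so having the same members makes them equal. *)
  apply: (irr_sorted_eq ltn_trans ltnn); first by rewrite /= lt01 lt12.
    by apply: sorted_filter; [exact: ltn_trans | exact: iota_ltn_sorted].
  move=> i; rewrite mem_filter mem_iota /= !inE.
  by do !case: eqP => [->|_] //=; rewrite add0n ?ltn_ord.
(* Masking the positions instead of the letters recovers the three increasing indices. *)
- have : [:: x; y; z] = map (nth 0 w) (mask m (iota 0 (size w))).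
    by rewrite map_mask -/(mkseq _ _) mkseq_nth.
  have := subseq_sorted ltn_trans (mask_subseq m (iota 0 (size w)))
    (iota_ltn_sorted 0 (size w)).
  have := fun i => @mem_mask _ i m (iota 0 (size w)).
  case: (mask _ _) => [|i [|j [|k []]]] //= lt_w /and3P[ij jk _] [xE yE zE].
  have [iw jw kw] : [/\ i < size w, j < size w & k < size w].
    by split; move: (lt_w i) (lt_w j) (lt_w k); rewrite !inE !eqxx ?orbT !mem_iota /=; lia.
  exists [ffun a : 'I_3 => nth (Ordinal iw) [:: Ordinal iw; Ordinal jw; Ordinal kw] a].
  apply/forallP => -[[|[|[|]]] //= lta]; apply/forallP => -[[|[|[|]]] //= ltb];
    rewrite !ffunE /= -?xE -?yE -?zE; lia.
Qed.

Definition valid210 (w : seq nat) := is_catalan w && avoids [:: 2; 1; 0] w.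

Lemma valid210_catl (u w : seq nat) : valid210 (u ++ w) -> valid210 u.
Proof.
case/andP=> /andP[hd0 srt] /contains210P av; apply/andP; split.
  by rewrite /is_catalan (cat_sorted2 srt).1 andbT; case: u hd0 {srt av}.
apply/contains210P => -[x [y [z [zy yx sub]]]]; apply: av.
by exists x, y, z; split=> //; exact: subseq_trans sub (prefix_subseq _ _).
Qed.

(* [M] is the largest letter of [u], and [b] the largest letter that has a
   greater letter to its left, or [0] if there is none. *)
Definition scan_state (u : seq nat) (M b : nat) : Prop :=
  [/\ {in u, forall x, x <= M}, M \in u,
      forall x y, y < x -> subseq [:: x; y] u -> y <= b &
      b = 0 \/ exists2 x, b < x & subseq [:: x; b] u].

(** An admissible letter satisfies [b <= a], so if it lies below [M] it becomes the new largest
    letter with a greater one to its left. *)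
Definition next_low (M b a : nat) := if a < M then a else b.

(** A new occurrence of 210 must use [a] as its 0, below a letter that already has a greater one to
    its left; this happens exactly when [a < b]. The upper bound is the Catalan condition. *)
Lemma valid210_rcons u M b a : scan_state u M b -> valid210 u ->
  valid210 (rcons u a) = (b <= a <= (last 0 u).+1).
Proof.
move=> [_ uM ub bP] /andP[/andP[hd0 srt] /contains210P av].
rewrite /valid210 andbC; congr andb; last first.
  case: u uM hd0 srt {ub bP av} => [|h t] // _ hd0 srt.
  by rewrite /is_catalan /= hd0 rcons_path -[path _ h t]/(sorted _ (h :: t)) srt.
apply/idP/idP => [/contains210P avua|ba].
  rewrite leqNgt; apply/negP => ab; case: bP => [b0|[x bx sub]].
    by rewrite b0 in ab.
  by apply: avua; exists x, b, a; split; rewrite // (subseq_rcons2 [:: x; b]) eqxx sub orbT.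
apply/contains210P => -[x [y [z [zy yx]]]].
rewrite (subseq_rcons2 [:: x; y]) => /orP[sub|/andP[/eqP za sub]].
  by apply: av; exists x, y, z.
by have := ub _ _ yx sub; lia.
Qed.

Lemma scan_state_rcons u M b a : scan_state u M b -> b <= a ->
  scan_state (rcons u a) (maxn M a) (next_low M b a).
Proof.
rewrite /next_low => -[leM uM ub bP] ba; split.
- by move=> x; rewrite mem_rcons inE => /predU1P[->|/leM]; lia.
- rewrite mem_rcons inE; case: (leqP M a) => Ma.
    by rewrite eqxx.
  by rewrite uM orbT.
- move=> x y yx; rewrite (subseq_rcons2 [:: x]) sub1seq.
  case/orP=> [/(ub _ _ yx)|/andP[/eqP ya /leM]]; case: ltnP; lia.
- case: ltnP => aM.
    by right; exists M; rewrite // (subseq_rcons2 [:: M]) sub1seq uM eqxx orbT.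
  case: bP => [->|[x bx sub]]; [by left | right; exists x => //].
  exact: subseq_trans sub (subseq_rcons _ _).
Qed.

(** * Enumeration of the continuations from a state, [c] being the last letter read *)

Fixpoint extends (M c b : nat) (w : seq nat) : bool :=
  if w is a :: w' then
    (b <= a <= c.+1) && extends (maxn M a) a (next_low M b a) w'
  else true.

Lemma valid210_cat w u M b : scan_state u M b -> valid210 u ->
  valid210 (u ++ w) = extends M (last 0 u) b w.
Proof.
elim: w u M b => [|a w IHw] u M b st vu /=; first by rewrite cats0.
have := valid210_rcons a st vu; rewrite -cat_rcons.
case vua: (valid210 (rcons u a)) => /esym ba; rewrite ba /=.
  have /andP[le_ba _] := ba.
  by rewrite (IHw _ _ _ (scan_state_rcons st le_ba) vua) last_rcons.
(* A letter out of range spoils a prefix, hence the whole word. *)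
by apply/negP => /valid210_catl; rewrite vua.
Qed.

Lemma valid210_cons a w : valid210 (a :: w) = (a == 0) && extends 0 0 0 w.
Proof.
case: eqP => [->|/eqP a0] /=; last by rewrite /valid210 /is_catalan /= (negbTE a0).
rewrite -cat1s (@valid210_cat _ _ 0 0) //.
  split=> [x|//|x y _ /size_subseq //|]; last by left.
  by rewrite inE => /eqP->.
rewrite /valid210 /is_catalan /=; apply/contains210P => -[x [y [z [_ _]]]].
by move/size_subseq.
Qed.

Fixpoint extensions (n M c b : nat) : seq (seq nat) :=
  if n is n'.+1 then
    [seq a :: w | a <- iota b (c.+2 - b),
                  w <- extensions n' (maxn M a) a (next_low M b a)]
  else [:: [::]].

Lemma mem_extensions n M c b w :
  (w \in extensions n M c b) = (size w == n) && extends M c b w.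
Proof.
elim: n M c b w => [|n IHn] M c b w; first by case: w.
apply/allpairsPdep/idP => [[a [w' [ab w'P ->]]]|].
  move: w'P ab; rewrite IHn mem_iota /= eqSS => /andP[-> ->]; rewrite andbT /=.
  by lia.
case: w => [|a w] //= /and3P[sz ab ext]; exists a, w; split=> //.
  by rewrite mem_iota; lia.
by rewrite IHn -eqSS sz.
Qed.

Lemma extensions_uniq n M c b : uniq (extensions n M c b).
Proof.
elim: n M c b => [|n IHn] M c b //=.
apply: allpairs_uniq_dep => [|a _|]; [exact: iota_uniq | exact: IHn | ].
by move=> [a w] [a' w'] _ _ /= [-> ->].
Qed.

(** * Descents, and the counts in terms of continuations *)

Fixpoint descents_from (c : nat) (w : seq nat) : nat :=
  if w is a :: w' then (a < c) + descents_from a w' else 0.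

Lemma descents_cons c w : descents (c :: w) = descents_from c w.
Proof.
rewrite /descents -sum1_card big_mkcond /=.
elim: w c => [|a w IHw] c /=; first by rewrite big_ord0.
rewrite big_ord_recl inE /= -IHw; congr addn.
by apply: eq_bigr => i _; rewrite !inE.
Qed.

Lemma catalan_count210_0 k : catalan_count [:: 2; 1; 0] 0 k = (k == 0).
Proof.
have v0 : valid210 [::] by apply/contains210P => -[x [y [z [_ _]]]].
have d0 : descents [::] = 0 by rewrite /descents eq_card0 // => -[].
have E t : (t \in [set w in catalan_avoiding [:: 2; 1; 0] 0 |
    descents (map val w) == k]) = (k == 0).
  by rewrite !inE (tuple0 t) -/(valid210 [::]) v0 d0 eq_sym.
rewrite /catalan_count; case: k E => [|k] E; last by rewrite eq_card0.
by rewrite eq_cardT // -cardT card_tuple.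
Qed.

(** Removing the leading [0] is a bijection onto the continuations of length [n] of the one-letter
    word. *)
Lemma catalan_count210S n k :
  catalan_count [:: 2; 1; 0] n.+1 k =
  count (fun w => descents_from 0 w == k) (extensions n 0 0 0).
Proof.
rewrite -size_filter -(size_map (cons 0)) /catalan_count cardE.
rewrite -(size_map (fun t : n.+1.-tuple 'I_n.+1 => map val t)).
apply/perm_size/uniq_perm.
- rewrite map_inj_uniq ?enum_uniq // => s t /(inj_map val_inj) st.
  exact: val_inj.
- by rewrite map_inj_uniq ?filter_uniq ?extensions_uniq // => s t [].
move=> w; apply/mapP/mapP => [[t]|[v]].
  rewrite mem_enum !inE => /andP[vt dt] wE.
  case: w wE => [|a w] wE; first by move: (size_tuple t); rewrite -(size_map val) -wE.
  have [sz] : size (a :: w) = n.+1 by rewrite wE size_map size_tuple.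
  rewrite -wE -/(valid210 _) valid210_cons descents_cons in vt dt.
  have /andP[/eqP a0 ext] := vt; exists w; last by rewrite a0.
  by rewrite mem_filter mem_extensions ext andbT sz eqxx andbT -[X in descents_from X]a0.
rewrite mem_filter mem_extensions => /and3P[dv /eqP sz ext] ->.
have vv : valid210 (0 :: v) by rewrite valid210_cons.
have szt : size (map (@inord n) (0 :: v)) == n.+1 by rewrite size_map /= sz.
have tE : map val (Tuple szt) = 0 :: v.
  rewrite -map_comp map_id_in // => a av /=.
  (* Letters are smaller than the length, so [inord] does not alter them. *)
  have /andP[/is_catalan_lt_size/allP lt_sz _] := vv.
  by rewrite inordK // -sz; exact: lt_sz.
exists (Tuple szt); last by rewrite tE.
by rewrite mem_enum !inE tE -/(valid210 _) vv descents_cons.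
Qed.

Local Open Scope ring_scope.

(** * Closed forms, with [u], [v], [w] for the inverses of [1 - x], [1 - 2 * x], [D] *)

Section ClosedForms.
Variables (A : comNzRingType) (x y u v w : A).
Let D := 1 - 4 * x + 4 * x ^+ 2 - x ^+ 2 * y + x ^+ 3 * y.
Hypotheses (uE : u * (1 - x) = 1) (vE : v * (1 - 2 * x) = 1) (wE : w * D = 1).

Let r := x * u.
Let U := x * y * v * (1 - x) * w.

(** The constant solution [v] of the recurrence for [L], plus a multiple of its homogeneous solution
    [r ^+ d]. *)
Definition low_gf d := v + r ^+ d * U.

Definition top_gf d :=
  v * (1 + x ^+ 2 * y * v ^+ 2 + x ^+ 2 * y * v * U) + x * y * v ^+ 2 * d%:R
  - x ^+ 2 * y * U * (1 - x) * v ^+ 2 * r ^+ d.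

Let rE : r * (1 - x) = x.
Proof. by rewrite /r -mulrA uE mulr1. Qed.

Lemma low_gfS d : low_gf d.+1 = 1 + x * (low_gf d.+1 + low_gf d).
Proof.
apply/eqP; rewrite -subr_eq0 /low_gf exprS.
(* The difference of the two sides is written as a combination of [v * (1 - 2 * x) - 1] and
   [r * (1 - x) - x], which both vanish; the next proofs do likewise. *)
have -> : v + r * r ^+ d * U - (1 + x * (v + r * r ^+ d * U + (v + r ^+ d * U)))
  = (v * (1 - 2 * x) - 1) + r ^+ d * U * (r * (1 - x) - x) by ring.
by rewrite vE rE !subrr mulr0 addr0.
Qed.

Lemma sum_low_gf d :
  \sum_(j < d) low_gf j.+1 = d%:R * v + U * x * v * (1 - r ^+ d).
Proof.
elim: d => [|d IHd]; first by rewrite big_ord0 expr0; ring.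
rewrite big_ord_recr IHd /= /low_gf exprS.
apply/eqP; rewrite -subr_eq0 -natr1.
have -> : d%:R * v + U * x * v * (1 - r ^+ d) + (v + r * r ^+ d * U)
    - ((d%:R + 1) * v + U * x * v * (1 - r * r ^+ d))
  = U * r ^+ d * (v * (x * r - x) + r) by ring.
have -> : v * (x * r - x) + r = - r * (v * (1 - 2 * x) - 1) + v * (r * (1 - x) - x) by ring.
by rewrite vE rE !subrr !mulr0 addr0 mulr0.
Qed.

Lemma top_gfE d :
  top_gf d = 1 + x * (top_gf d.+1 + top_gf d + y * \sum_(j < d) low_gf j.+1).
Proof.
apply/eqP; rewrite -subr_eq0 sum_low_gf /top_gf (exprS r d) -(natr1 d).
move: (r ^+ d) d%:R => s e.
set t := (X in X == 0).
have -> : t = (x * y * v * e + (1 + x ^+ 2 * y * v ^+ 2 + x ^+ 2 * y * v * U)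
    - s * x ^+ 2 * y * U * v) * (v * (1 - 2 * x) - 1)
    + s * x ^+ 3 * y * U * v ^+ 2 * (r * (1 - x) - x).
  by rewrite /t; ring.
by rewrite vE rE !subrr !mulr0 addr0.
Qed.

(** This boundary condition is a linear equation for [U], and solving it produces the denominator
    [D]. *)
Lemma top_gf1 : top_gf 1 = low_gf 0.
Proof.
apply/eqP; rewrite -subr_eq0 /top_gf /low_gf expr1 expr0 mulr1 mul1r.
set t := (X in X == 0).
have -> : t = - (x ^+ 2 * y * U * v ^+ 2) * (r * (1 - x) - x)
    + (U * (v * (1 - 2 * x) + 1) - x * y * v ^+ 2) * (v * (1 - 2 * x) - 1)
    - x * y * v ^+ 3 * (1 - x) * (w * D - 1).
  by rewrite /t /U /D; ring.
by rewrite vE rE wE !subrr !mulr0 addr0 subr0.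
Qed.

Lemma top_gf0 :
  (1 + x * top_gf 0) * ((1 - 2 * x) * D) =
  1 - 5 * x + 8 * x ^+ 2 - x ^+ 2 * y - 4 * x ^+ 3 + 3 * x ^+ 3 * y - x ^+ 4 * y.
Proof.
have -> : (1 + x * top_gf 0) * ((1 - 2 * x) * D) =
    (1 - 2 * x) * D + x * (v * (1 - 2 * x)) * D
    + x ^+ 3 * y * v ^+ 2 * (v * (1 - 2 * x)) * D
    + x ^+ 5 * y ^+ 2 * v ^+ 2 * (1 - x) * (v * (1 - 2 * x)) * (w * D).
  by rewrite /top_gf expr0 /U; ring.
rewrite vE wE !mulr1.
(* Since [D = (1 - 2 * x) ^+ 2 - x ^+ 2 * y * (1 - x)], the remaining terms in [v ^+ 2] cancel. *)
have -> : x ^+ 3 * y * v ^+ 2 * D = x ^+ 3 * y * (v * (1 - 2 * x)) ^+ 2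
    - x ^+ 5 * y ^+ 2 * v ^+ 2 * (1 - x) by rewrite /D; ring.
by rewrite vE /D; ring.
Qed.

End ClosedForms.

(** * Coefficients of formal power series *)

Section FpsCoefficients.
Variable R : comNzRingType.
Implicit Types f g : fps R.

Lemma coefs_add f g n : coefs (f + g) n = coefs f n + coefs g n.
Proof. by []. Qed.

Lemma coefs_sum (I : Type) (s : seq I) (P : pred I) (F : I -> fps R) n :
  coefs (\sum_(i <- s | P i) F i) n = \sum_(i <- s | P i) coefs (F i) n.
Proof. exact: (big_morph (fun f => coefs f n) (fun f g => coefs_add f g n)). Qed.

Lemma coefs_mul0 f g : coefs (f * g) 0%N = coefs f 0%N * coefs g 0%N.
Proof. by rewrite /= big_ord_recl big_ord0 addr0. Qed.

Lemma coefs_fpsX_mul f n : coefs (fpsX R * f) n.+1 = coefs f n.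
Proof.
rewrite /= !big_ord_recl /= mul0r add0r mul1r subSS subn0 big1 ?addr0 // => i _.
by rewrite mul0r.
Qed.

Lemma coefs_fpsC_mul (c : R) f n : coefs (fpsC c * f) n = c * coefs f n.
Proof.
by rewrite /= big_ord_recl /= subn0 big1 ?addr0 // => i _; rewrite mul0r.
Qed.

Lemma coefs_fpsX_exp m n : coefs (fpsX R ^+ m) n = (n == m)%:R.
Proof.
elim: m n => [|m IHm] [|n] //; rewrite exprS ?coefs_fpsX_mul ?IHm //.
by rewrite coefs_mul0 mul0r.
Qed.

End FpsCoefficients.

(** * Descent polynomials as the coefficients of any solution of the system *)

Section DescentPolynomials.
Variables (T L : nat -> fps2).
Hypotheses
  (TE : forall d, T d =
     1 + varx * (T d.+1 + T d + vary * \sum_(j < d) L j.+1))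
  (LS : forall d, L d.+1 = 1 + varx * (L d.+1 + L d))
  (T1 : T 1%N = L 0%N).

Definition descent_poly (n M c b : nat) : fps int :=
  \sum_(w <- extensions n M c b) fpsX int ^+ descents_from c w.

Lemma descent_polyS n M c b : descent_poly n.+1 M c b =
  \sum_(a <- iota b (c.+2 - b))
    fpsX int ^+ (a < c) * descent_poly n (maxn M a) a (next_low M b a).
Proof.
rewrite /descent_poly big_allpairs_dep; apply: eq_bigr => a _.
by rewrite big_distrr; apply: eq_bigr => w _; rewrite /= exprD.
Qed.

Let coefs_step (F G : fps2) : F = 1 + varx * G ->
  coefs F 0%N = 1 /\ forall n, coefs F n.+1 = coefs G n.
Proof.
move=> ->; split=> [|n]; rewrite coefs_add; last by rewrite coefs_fpsX_mul add0r.
by rewrite coefs_mul0 mul0r addr0.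
Qed.

(** The two kinds of state, last letter equal to [M] or below it, lead to each other, so both are
    treated in one induction; the factor [varx] shifts the coefficients by one. *)
Lemma descent_polyE n :
  (forall M b, (b <= M)%N -> descent_poly n M M b = coefs (T (M - b)) n) /\
  (forall M c, (c < M)%N -> descent_poly n M c c = coefs (L (M - c)) n).
Proof.
elim: n => [|n [IHT IHL]]; split=> M b bM.
- by rewrite (coefs_step (TE _)).1 /descent_poly big_seq1.
- rewrite -(subnSK bM) (coefs_step (LS _)).1 /descent_poly big_seq1 //.
- rewrite (coefs_step (TE _)).2 descent_polyS !coefs_add coefs_fpsC_mul coefs_sum.
  (* The next letter is one of the [M - b] letters below [M], each making a descent, or [M], or
     [M + 1]. *)
  have -> : (M.+2 - b = (M - b) + 2)%N by lia.
  rewrite iotaD big_cat /= subnKC // big_cons big_seq1 ltnn ltnNge leqnSn.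
  rewrite !mul1r maxnn (maxn_idPr (leqnSn M)) /next_low ltnn ltnNge leqnSn /=.
  rewrite !IHT ?leqW // subSn // [in RHS]addrC [coefs _ n + coefs _ n]addrC.
  congr (_ + _).
  have -> : iota b (M - b) = [seq (b + i)%N | i <- index_iota 0 (M - b)].
    by rewrite /index_iota subn0 -iotaDl addn0.
  rewrite big_map big_mkord [in RHS]big_distrr /=.
  (* Reversing the sum lets the letter [a] with [M - a = i + 1] match the term [L i.+1]. *)
  rewrite (reindex_inj rev_ord_inj) /=; apply: eq_bigr => i _.
  have iMb := ltn_ord i.
  have aM : (b + (M - b - i.+1) < M)%N by lia.
  rewrite aM (maxn_idPl (ltnW aM)) IHL // expr1; congr (_ * coefs (L _) n).
  by lia.
- rewrite -(subnSK bM) (coefs_step (LS _)).2 coefs_add subnSK // descent_polyS.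
  have -> : (b.+2 - b = 2)%N by lia.
  rewrite /= big_cons big_seq1 ltnn ltnNge leqnSn !mul1r.
  rewrite (maxn_idPl (ltnW bM)) (maxn_idPl bM) /next_low bM IHL //; congr (_ + _).
  (* The letter [b + 1] either stays below [M] or reaches it; the latter gives [T 1], whence the
     convention for [L 0]. *)
  case: ltnP => [bM'|Mb]; first by rewrite IHL.
  have -> : M = b.+1 by lia.
  by rewrite IHT // subnn subSnn T1.
Qed.

(** The [1] counts the empty word, and [varx] the leading [0], after which [M = c = b = 0]. *)
Lemma catalan_gf210 : catalan_gf [:: 2; 1; 0]%N = 1 + varx * T 0%N.
Proof.
apply: fpsP => n; apply: fpsP => k.
have [cst coefS] := coefs_step (erefl (1 + varx * T 0%N)).
case: n => [|n]; first by rewrite cst /= catalan_count210_0.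
rewrite coefS -[X in T X]/(0 - 0)%N -(descent_polyE n).1 // coefs_sum /=.
rewrite catalan_count210S -sum1_count natr_sum [LHS]big_mkcond;
  apply: eq_bigr => w _ /=.
by rewrite coefs_fpsX_exp eq_sym; case: eqP.
Qed.

End DescentPolynomials.

Theorem theorem13 :
  let x := varx in
  let y := vary in
  catalan_gf [:: 2; 1; 0]%N =
    (1 - 5 * x + 8 * x ^+ 2 - x ^+ 2 * y - 4 * x ^+ 3 + 3 * x ^+ 3 * y
      - x ^+ 4 * y)
    / ((1 - 2 * x) * (1 - 4 * x + 4 * x ^+ 2 - x ^+ 2 * y + x ^+ 3 * y)).
Proof.
move=> x y; set P := 1 - 2 * x; set D := 1 - 4 * x + _ - _ + _.
have unit_subX (f : fps2) : 1 - x * f \is a GRing.unit.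
  apply/fps_unitP; rewrite coefs_add -[coefs (- _) _]/(- coefs _ _) coefs_mul0.
  by rewrite mul0r oppr0 addr0 unitr1.
have uX : 1 - x \is a GRing.unit by rewrite -[x]mulr1.
have uP : P \is a GRing.unit by rewrite /P mulrC.
have uD : D \is a GRing.unit.
  have -> : D = 1 - x * (4 - 4 * x + x * y - x ^+ 2 * y) by rewrite /D; ring.
  exact: unit_subX.
(* As the denominator is a unit, the quotient reduces to the identity [top_gf0]. *)
apply: (canRL (mulrK _)); first by rewrite unitrM uP.
have xE := mulVr uX; have pE := mulVr uP; have dE := mulVr uD.
rewrite (catalan_gf210 (top_gfE y D^-1 xE pE) (low_gfS y D^-1 xE pE)
  (top_gf1 xE pE dE)).
exact: top_gf0 pE dE.
Qed.
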